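(* Let $(x_n)_{n\ge1}$ be a sequence of real numbers such that $x_{n+1}-x_n\ge\frac{c\log n}{n}$ for some constant $c>0$. Suppose that for some $\varepsilon_0>0$, $$\mathrm{cov}\big(X_N-X_N,\gamma_N\big)\ll N,\qquad \gamma_N=\frac{1}{N(\log N)^{1+\varepsilon_0}}.$$ Then for every $\varepsilon>0$ and almost every $\alpha\in\mathbb{R}$, $$\delta_{\min}^{\alpha}(N)\gg\frac{1}{N(\log N)^{1+\varepsilon}},$$ with implied constant depending on $\alpha,\varepsilon$.
   Context: $X_N=\{x_1,\dots,x_N\}$ and $X_N-X_N=\{a-b : a,b\in X_N\}$. For $A\subset\mathbb{R}$ and $\gamma>0$, the covering number is $\mathrm{cov}(A,\gamma)=\inf\{|B| : B\subset\mathbb{R},\ \forall a\in A\ \exists b\in B,\ |a-b|<\gamma\}$. For $x\in\mathbb{R}$, $\|x\|=\min_{k\in\mathbb{Z}}|x-k|$, and $\delta_{\min}^{\alpha}(N)=\min\{\|\alpha x_m-\alpha x_n\| : 1\le m,n\le N,\ m\ne n\}$.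
   Formalization: The terms x_n are additionally assumed distinct, i.e. x_1 ≠ x_2: the gap condition at n=1 allows x_1 = x_2 (log 1 = 0), and then δ_min(N)=0 for all N≥2 and the claim fails (e.g. x_1=x_2=0, x_n=n for n≥3). *)

(* Defs.v *)
From HB Require Import structures.
From mathcomp Require Import all_boot all_order all_algebra.
From mathcomp Require Import all_classical all_reals all_analysis.
Set Implicit Arguments. Unset Strict Implicit. Unset Printing Implicit Defensive.
Import Order.TTheory GRing.Theory Num.Theory.
Local Open Scope classical_set_scope.
Local Open Scope ring_scope.

Definition diffset (R : realType) (x : nat -> R) (N : nat) : set R :=
  [set d | exists m n, [/\ (1 <= m <= N)%N, (1 <= n <= N)%N & d = x m - x n]].

Definition covers (R : realType) (A : set R) (B : seq R) (gamma : R) : Prop :=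
  forall a, A a -> exists2 b, b \in B & `|a - b| < gamma.

Definition cov (R : realType) (A : set R) (gamma : R) : R :=
  inf [set (size (undup B))%:R | B in [set B : seq R | covers A B gamma]].

Definition dist_int (R : realType) (y : R) : R :=
  inf [set `|y - k%:~R| | k in [set: int]].

Definition delta_min (R : realType) (x : nat -> R) (alpha : R) (N : nat) : R :=
  inf [set d | exists m n, [/\ (1 <= m <= N)%N, (1 <= n <= N)%N, m != n &
                               d = dist_int (alpha * x m - alpha * x n)]].

(* Main.v *)
(** It is enough to control the scales N = 2^k. Fix A > 0 and consider |alpha| <= A.
    A difference d of the sequence with |d| < 1/(2A) satisfies |alpha d| < 1/2, so
    ||alpha d|| = |alpha| |d|, and |d| >> 1/N by the gap condition. Each other
    difference is within gamma_N of one of O(N) centres b with |b| >= 1/(4A), and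
    ||alpha d|| < psi then forces ||alpha b|| < psi + A gamma_N. For a fixed b this
    happens on a set of measure O(psi + A gamma_N), so for psi = 1/(N k^(1+eps)) the bad
    alphas at scale 2^k have measure O(k^(-1-min(eps,eps0))), which is summable, and
    the Borel-Cantelli lemma applies. *)

Require Import Defs.
From HB Require Import structures.
From mathcomp Require Import all_boot all_order all_algebra.
From mathcomp Require Import all_classical all_reals all_analysis.
From mathcomp Require Import ring lra zify.
Import Order.TTheory GRing.Theory Num.Theory.
Local Open Scope classical_set_scope.
Local Open Scope ring_scope.

(** * Explicit bound for the convergent series of powers above 1 *)

Section inverse_power_series.
Context {R : realType}.
Implicit Type a : R.

Lemma inverse_power_le_telescope a (n : nat) : 0 < a ->
  a * (n.+2%:R `^ (1 + a))^-1 <= n.+1%:R `^ (- a) - n.+2%:R `^ (- a).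
Proof.
move=> a0.
have n1 : 0 < n.+1%:R :> R by rewrite ltr0n.
have n2 : 0 < n.+2%:R :> R by rewrite ltr0n.
(* The ratio of consecutive terms is [expR (a * ln (1 + 1 / n.+1))], and [1 + t <= expR t]. *)
have -> : n.+1%:R `^ (- a) = n.+2%:R `^ (- a) * expR (a * (ln n.+2%:R - ln n.+1%:R)) :> R.
  rewrite /powR !gt_eqF// -expRD; congr expR; ring.
have lnle : n.+2%:R^-1 <= ln n.+2%:R - ln n.+1%:R :> R.
  rewrite -lerN2 opprB -ln_div ?posrE//.
  have -> : n.+1%:R / n.+2%:R = 1 + - n.+2%:R^-1 :> R.
    by rewrite -(natr1 n.+1) in n2 *; field; lra.
  apply: le_ln1Dx; rewrite ltrN2 invf_lt1 // ltr1n //.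
have ge := expR_ge1Dx (a * (ln n.+2%:R - ln n.+1%:R)).
have -> : (n.+2%:R `^ (1 + a))^-1 = n.+2%:R `^ (- a) * n.+2%:R^-1 :> R.
  rewrite powRD; last by rewrite (gt_eqF n2) implybT.
  by rewrite powRr1 ?ltW // powRN invfM mulrC.
have p0 : 0 < n.+2%:R `^ (- a) :> R by exact: powR_gt0.
rewrite -[X in _ - X]mulr1 -mulrBr mulrCA ler_pM2l //.
rewrite lerBrDl; apply: le_trans ge; rewrite lerD2l.
exact: (ler_wpM2l (ltW a0) lnle).
Qed.

Lemma sum_inverse_power_le a (n : nat) : 0 < a ->
  \sum_(0 <= i < n) (i.+1%:R `^ (1 + a))^-1 <= 1 + a^-1.
Proof.
move=> a0.
(* The induction closes only if the telescoped tail [m.+1 ^ (- a)] is kept in the bound; it is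
   dropped at the end. *)
suff H m : \sum_(0 <= i < m.+1) (i.+1%:R `^ (1 + a))^-1 <=
    1 + a^-1 * (1 - m.+1%:R `^ (- a)).
  case: n => [|n]; first by rewrite big_nil addr_ge0 ?invr_ge0 ?ltW.
  apply: (le_trans (H n)); rewrite lerD2l ler_piMr //; first by rewrite invr_ge0 ltW.
elim: m => [|m IH]; first by rewrite big_nat1 !powR1 invr1; lra.
rewrite big_nat_recr //=; apply: (le_trans (lerD IH (lexx _))).
have ai0 : 0 <= a^-1 by rewrite invr_ge0 ltW.
have := ler_wpM2l ai0 (inverse_power_le_telescope _ m a0).
rewrite mulKf ?gt_eqF//; lra.
Qed.

End inverse_power_series.

(** * Subadditivity and a Borel-Cantelli criterion *)

Section measure_of_unions.
Context {R : realType}.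
Local Notation mu := (@lebesgue_measure R).

Lemma measure_bigsetU_seq_le (I : eqType) (s : seq I) (F : I -> set R) (c : R) :
  (forall i, i \in s -> measurable (F i)) ->
  (forall i, i \in s -> (mu (F i) <= c%:E)%E) ->
  measurable (\big[setU/set0]_(i <- s) F i) /\
  (mu (\big[setU/set0]_(i <- s) F i) <= ((size s)%:R * c)%:E)%E.
Proof.
elim: s => [|i s IH] mF cF; first by rewrite big_nil measure0 mul0r.
have [||ms IHs] := IH; try by move=> k ks; (apply: mF || apply: cF); rewrite in_cons ks orbT.
have mi : measurable (F i) by apply: mF; rewrite in_cons eqxx.
rewrite big_cons; split; first exact: measurableU.
apply: (le_trans (measureU2 _ _ _)) => //.
rewrite -[size _]addn1 natrD mulrDl mul1r addrC EFinD leeD//.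
by apply: cF; rewrite in_cons eqxx.
Qed.

Lemma negligible_lim_sup_set (E : nat -> set R) (C a : R) : 0 < a ->
  (forall n, measurable (E n)) ->
  (forall n, (mu (E n) <= (C * (n.+1%:R `^ (1 + a))^-1)%:E)%E) ->
  mu.-negligible (lim_sup_set E).
Proof.
move=> a0 mE bE.
(* The weight at [n = 0] is 1, so the bound there already forces the sign of [C]. *)
have C0 : 0 <= C.
  have := le_trans (measure_ge0 mu (E 0%N)) (bE 0%N).
  by rewrite powR1 invr1 mulr1 lee_fin.
have mL : measurable (lim_sup_set E).
  by apply: bigcap_measurable => // n _; apply: bigcup_measurable => k _; exact: mE.
exists (lim_sup_set E); split => //.
apply: lim_sup_set_cvg0 => //.
apply: (@le_lt_trans _ _ (C * (1 + a^-1))%:E); last exact: ltry.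
apply: lime_le; first exact: is_cvg_nneseries.
apply: nearW => n.
apply: (@le_trans _ _ (\sum_(0 <= i < n) (C * (i.+1%:R `^ (1 + a))^-1)%:E)%E).
  by apply: lee_sum => i _; exact: bE.
by rewrite sumEFin lee_fin -mulr_sumr ler_wpM2l// sum_inverse_power_le.
Qed.

End measure_of_unions.

(** * Multipliers that bring a fixed real close to an integer *)

Section near_integers.
Context {R : realType}.
Local Notation mu := (@lebesgue_measure R).

Lemma int_eq_nat_shift (k : int) (M : nat) : (`|k| <= M)%N ->
  exists2 i : nat, (i < 2 * M + 1)%N & k = i%:Z - M%:Z.
Proof. by move=> kM; exists `|(k + M%:Z)%R|%N; lia. Qed.

(** Being within [eta] of [k] after multiplication by [b] puts [alpha] in the ball of radius
    [eta / |b|] about [k / b]. With [|alpha| <= A] and [eta <= 1], only integers [|k| <= M] occur,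
    where [M <= A * |b| + 1]; hence at most [2 * A * |b| + 3] balls. *)
Lemma near_int_set (A b eta : R) : 0 <= A -> b != 0 -> 0 <= eta <= 1 ->
  exists E : set R, [/\ measurable E,
    (mu E <= ((2 * A * `|b| + 3) * (2 * eta / `|b|))%:E)%E &
    forall (alpha : R) (k : int), `|alpha| <= A ->
      `|alpha * b - k%:~R| < eta -> E alpha].
Proof.
move=> A0 b0 /andP[eta0 eta1].
have nb : 0 < `|b| by rewrite normr_gt0.
have Ab0 : 0 <= A * `|b| by rewrite mulr_ge0.
pose M := (Num.truncn (A * `|b|)).+1.
have [Mlo Mhi] : M%:R <= A * `|b| + 1 /\ A * `|b| < M%:R.
  have /andP[h1 h2] := truncn_itv Ab0; split => //.
  by rewrite /M -addn1 natrD lerD2r.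
pose s := iota 0 (2 * M + 1).
pose F (i : nat) := ball ((i%:R - M%:R) / b) (eta / `|b|).
have [||mE bE] := @measure_bigsetU_seq_le R nat s F (2 * eta / `|b|).
- by move=> i _; rewrite /F ball_itv; exact: measurable_itv.
- move=> i _; rewrite /F lebesgue_measure_ball ?divr_ge0// lee_fin mulr2n; lra.
exists (\big[setU/set0]_(i <- s) F i); split => //.
  apply: (le_trans bE); rewrite lee_fin ler_wpM2r ?divr_ge0 ?mulr_ge0 //.
  by rewrite size_iota natrD natrM; lra.
move=> alpha k alA near.
have kM : `|k%:~R| < M%:R + 1 :> R.
  have -> : k%:~R = alpha * b - (alpha * b - k%:~R) by ring.
  apply: (le_lt_trans (ler_normB _ _)).
  have : `|alpha * b| <= A * `|b| by rewrite normrM ler_wpM2r.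
  lra.
have {kM} kM : (`|k|%N <= M)%N.
  by rewrite -ltnS -(ltr_nat R) natr_absz intr_norm -natr1.
rewrite -bigcup_seq.
have [i iM kE] := int_eq_nat_shift k M kM.
exists i; first by rewrite /= mem_iota.
rewrite /F /ball /=.
have -> : i%:R - M%:R = k%:~R :> R by rewrite kE intrB.
have -> : k%:~R / b - alpha = - ((alpha * b - k%:~R) / b) by field.
by rewrite normrN normrM normfV ltr_pM2r // invr_gt0.
Qed.

End near_integers.

(** * Distance to the nearest integer *)

Section dist_int.
Context {R : realType}.
Implicit Types y r : R.

Lemma dist_int_ltP y r : dist_int y < r -> exists k : int, `|y - k%:~R| < r.
Proof.
move=> /inf_lt[|_ [k _ <-] lt]; last by exists k.
by exists `|y - 0%:~R|, 0.
Qed.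

(** A nonzero integer is at distance at least [1 - |y| >= 1/2] from [y], so 0 is a nearest one. *)
Lemma norm_le_dist_int y : `|y| <= 2^-1 -> `|y| <= dist_int y.
Proof.
move=> y2; apply: lb_le_inf; first by exists `|y - 0%:~R|, 0.
move=> _ [k _ <-].
have [->|k0] := eqVneq k 0; first by rewrite subr0.
have k1 : 1 <= `|k%:~R| :> R.
  by rewrite -intr_norm -[1]/(1%:~R) ler_int -gtz0_ge1 normr_gt0.
have := lerB_dist k%:~R y; rewrite distrC; lra.
Qed.

End dist_int.

(** * From a covering of the differences to a small bad set *)

Section coverings.
Context {R : realType}.
Local Notation mu := (@lebesgue_measure R).

(** The infimum of the empty set is 0 by convention, so some cover must be known to exist. The slack
    of 1 avoids showing that the infimum is attained. *)
Lemma cov_le_witness (A : set R) (gamma c : R) :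
  (exists B, covers A B gamma) -> cov A gamma <= c ->
  exists2 B, covers A B gamma & (size (undup B))%:R < c + 1.
Proof.
move=> [B0 cB0] covc.
have : cov A gamma < c + 1 by lra.
move=> /inf_lt[|_ [B cB <-] lt]; last by exists B.
by exists (size (undup B0))%:R, B0.
Qed.

Lemma diffset_covered (x : nat -> R) (N : nat) (gamma : R) : 0 < gamma ->
  exists B, covers (diffset x N) B gamma.
Proof.
move=> g0; exists [seq x m - x n | m <- iota 1 N, n <- iota 1 N].
move=> d [m [n [mN nN dE]]]; exists d; last by rewrite subrr normr0.
by rewrite dE; apply/allpairsP; exists (m, n); rewrite !mem_iota !add1n !ltnS.
Qed.

(** A centre [b] within [gamma <= beta] of some [|d| >= 2 * beta] has [|b| >= beta], so smaller
    centres can be discarded. Replacing [d] by [b] moves [alpha * d] by at most [A * gamma], which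
    enlarges the radius to [eta]; each kept centre costs at most
    [(2 * A + 3 / beta) * (2 * eta)]. *)
Lemma covered_bad_set (D : set R) (B : seq R) (A beta gamma psi : R) :
  0 <= A -> 0 < beta -> 0 <= gamma <= beta -> 0 <= psi ->
  psi + A * gamma <= 1 -> covers D B gamma ->
  exists E : set R, [/\ measurable E,
    (mu E <= ((size (undup B))%:R *
              ((2 * A + 3 / beta) * (2 * (psi + A * gamma))))%:E)%E &
    forall alpha d, `|alpha| <= A -> D d -> 2 * beta <= `|d| ->
      dist_int (alpha * d) < psi -> E alpha].
Proof.
move=> A0 beta0 /andP[g0 gb] psi0 eta1 DB.
set eta := psi + A * gamma in eta1 *.
have eta0 : 0 <= eta by rewrite addr_ge0 ?mulr_ge0.
pose s := [seq b <- undup B | beta <= `|b|].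
have sP b : b \in s -> beta <= `|b| by rewrite mem_filter => /andP[].
(* The guard [beta <= |b|] lets choice produce a function on all reals, with an arbitrary value at
   small centres. *)
pose P b (E : set R) := beta <= `|b| -> [/\ measurable E,
    (mu E <= ((2 * A * `|b| + 3) * (2 * eta / `|b|))%:E)%E &
    forall (alpha : R) (k : int), `|alpha| <= A ->
      `|alpha * b - k%:~R| < eta -> E alpha].
have /choice[F FP] : forall b, exists E, P b E.
  move=> b; rewrite /P; have [bb|_] := leP beta `|b|; last by exists set0.
  have b0 : b != 0 by rewrite -normr_gt0; exact: lt_le_trans bb.
  by have [|E EP] := near_int_set A b eta A0 b0 _; [rewrite eta0 | exists E].
pose c := (2 * A + 3 / beta) * (2 * eta).
have c_ge0 : 0 <= c by rewrite mulr_ge0 ?addr_ge0 ?mulr_ge0 ?invr_ge0// ltW.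
have [||mE bE] := @measure_bigsetU_seq_le R _ s F c.
- by move=> b /sP /(FP b)[].
- move=> b /sP bb; have [_ /le_trans + _] := FP b bb; apply.
  have b0 : 0 < `|b| by exact: lt_le_trans bb.
  rewrite lee_fin /c.
  have -> : (2 * A * `|b| + 3) * (2 * eta / `|b|) = (2 * A + 3 / `|b|) * (2 * eta).
    by field; rewrite gt_eqF.
  rewrite ler_wpM2r ?mulr_ge0// lerD2l ler_wpM2l// lef_pV2//.
exists (\big[setU/set0]_(b <- s) F b); split => //.
  apply: (le_trans bE); rewrite lee_fin (ler_wpM2r c_ge0)//.
  by rewrite ler_nat size_filter count_size.
move=> alpha d alA Dd db /dist_int_ltP[k near].
have [b bB bd] := DB d Dd.
have bb : beta <= `|b|.
  have := lerB_dist d b; lra.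
rewrite -bigcup_seq; exists b; first by rewrite /= mem_filter bb mem_undup.
have [_ _ FE] := FP b bb; apply: (FE alpha k alA).
have -> : alpha * b - k%:~R = (alpha * d - k%:~R) + alpha * (b - d) by ring.
apply: (le_lt_trans (ler_normD _ _)); rewrite /eta ltr_leD// normrM.
by rewrite ler_pM// distrC ltW.
Qed.

End coverings.

(** * Separation of the sequence *)

Section spacing.
Context {R : realType}.

(** As [ln 1 = 0], the gap condition gives only [x 1 <= x 2] at [n = 1], and distinctness supplies
    the first gap. For [n >= 2], [ln n >= ln 2]. By monotonicity, for [m < n] the difference is at
    least the gap following [x m]. *)
Lemma spacing_lower_bound (x : nat -> R) (c : R) : 0 < c ->
  (forall n : nat, (1 <= n)%N -> c * ln (n%:R) / n%:R <= x n.+1 - x n) ->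
  x 1%N != x 2%N ->
  exists2 g : R, 0 < g & forall N m n : nat,
    (1 <= m <= N)%N -> (1 <= n <= N)%N -> m != n -> g / N%:R <= `|x m - x n|.
Proof.
move=> c0 gap x12.
have ln2 : 0 < ln 2 :> R by apply: ln_gt0; rewrite ltr1n.
have d0 : 0 < x 2%N - x 1%N.
  have := gap 1%N isT; rewrite ln1 mulr0 mul0r subr_ge0 => le12.
  by rewrite subr_gt0 lt_neqAle x12.
pose g := Num.min (x 2%N - x 1%N) (c * ln 2).
have g0 : 0 < g by rewrite lt_min d0 mulr_gt0.
have step n : (1 <= n)%N -> g / n%:R <= x n.+1 - x n.
  case: n => [//|[_|n _]]; first by rewrite divr1 ge_min lexx.
  apply: le_trans (gap n.+2 isT); rewrite ler_wpM2r ?invr_ge0//.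
  rewrite ge_min; apply/orP; right; rewrite ler_pM2l // ler_ln ?posrE ?ltr0n// ler_nat//.
have mono m n : (1 <= m)%N -> (m <= n)%N -> x m <= x n.
  move=> m1; elim: n => [|n IH]; first by rewrite leqn0 => /eqP ->.
  rewrite leq_eqVlt => /predU1P[->//|]; rewrite ltnS => mn.
  apply: (le_trans (IH mn)); rewrite -subr_ge0.
  by apply: le_trans (step n (leq_trans m1 mn)); rewrite divr_ge0// ltW.
exists g => // N m n mN nN mn.
wlog lt : m n mN nN mn / (m < n)%N.
  move=> H; case: (ltngtP m n) (mn) => // ltmn _; first exact: H.
  by rewrite distrC; apply: H => //; rewrite eq_sym.
move: mN nN => /andP[m1 mN] /andP[n1 nN].
rewrite distrC; apply: le_trans (ler_norm _).
apply: (@le_trans _ _ (x m.+1 - x m)); last by rewrite lerD2r; apply: mono.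
apply: le_trans (step m m1); rewrite ler_wpM2l ?(ltW g0)// lef_pV2 ?posrE ?ltr0n ?ler_nat//.
exact: leq_trans mN.
Qed.

End spacing.

(** * Bad sets at the scales [2 ^ n.+1], and passage to all [N] *)

Section dyadic_scales.
Context {R : realType}.
Local Notation mu := (@lebesgue_measure R).

(* [n.+1] plays the role of [k] in [N = 2 ^ k], which keeps [k] positive. *)
Definition dyadic_threshold (s : R) (n : nat) : R :=
  (2 ^+ n.+1 * n.+1%:R `^ s)^-1.

Lemma dyadic_threshold_gt0 (s : R) (n : nat) : 0 < dyadic_threshold s n.
Proof. by rewrite invr_gt0 mulr_gt0 ?exprn_gt0 ?powR_gt0. Qed.

(** Lets every [N >= 2], however small, be handled at a scale past [n0]: take [n = n0 + t] with [t]
    the integer part of the binary logarithm of [N]. The shift costs a constant factor, since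
    [2 ^ n.+1 <= 2 ^ n0.+1 * N] and, as [t >= 1], [n.+1 <= n0.+2 * t <= M * ln N]. *)
Lemma dyadic_interpolation (s : R) (n0 : nat) : 0 <= s ->
  exists2 K : R, 0 < K & forall N : nat, (2 <= N)%N ->
    exists n : nat, [/\ (n0 <= n)%N, (N <= 2 ^ n.+1)%N &
      K / (N%:R * powR (ln (N%:R)) s) <= dyadic_threshold s n].
Proof.
move=> s0.
have ln2 : 0 < ln 2 :> R by apply: ln_gt0; rewrite ltr1n.
pose M : R := n0.+2%:R / ln 2.
have M0 : 0 < M by rewrite divr_gt0.
exists (2 ^+ n0.+1 * M `^ s)^-1.
  by rewrite invr_gt0 mulr_gt0 ?exprn_gt0 ?powR_gt0.
move=> N N2; have N0 : (0 < N)%N by exact: ltnW.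
have /andP[tlo thi] := trunc_log_bounds (isT : (1 < 2)%N) N0.
set t := trunc_log 2 N in tlo thi.
have t1 : (1 <= t)%N by rewrite /t trunc_log_gt0.
exists (n0 + t)%N; split; first exact: leq_addr.
  by apply: (leq_trans (ltnW thi)); rewrite leq_exp2l// ltnS leq_addl.
have lnN0 : 0 < ln N%:R :> R by rewrite ln_gt0// ltr1n.
rewrite -invfM lef_pV2 ?posrE ?mulr_gt0 ?exprn_gt0 ?powR_gt0 ?ltr0n//.
rewrite mulrACA ler_pM ?exprn_ge0 ?powR_ge0//.
  by rewrite -addSn exprD ler_wpM2l ?exprn_ge0// -natrX ler_nat.
rewrite -powRM ?(ltW M0) ?(ltW lnN0)//.
have MlnN : 0 <= M * ln N%:R by rewrite mulr_ge0// ltW.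
apply: ge0_ler_powR; rewrite ?nnegrE//.
have tln : t%:R * ln 2 <= ln N%:R :> R.
  rewrite mulr_natl -lnXn// ler_ln ?posrE ?exprn_gt0 ?ltr0n//.
  by rewrite -natrX ler_nat.
apply: (@le_trans _ _ (n0.+2%:R * t%:R)).
  by rewrite -natrM ler_nat mulSn addnC -addnS leq_add2l -[X in (X <= _)%N]muln1 leq_mul.
by rewrite /M -mulrA ler_wpM2l// mulrC ler_pdivlMr.
Qed.

Lemma bad_sequence (x : nat -> R) (eps0 eps C A : R) :
  0 < eps0 -> 0 < eps -> 0 < C -> 0 < A ->
  (forall N : nat, (2 <= N)%N ->
    cov (diffset x N) (1 / (N%:R * powR (ln (N%:R)) (1 + eps0))) <= C * N%:R) ->
  exists (E : nat -> set R) (n0 : nat), mu.-negligible (lim_sup_set E) /\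
    forall n alpha d, (n0 <= n)%N -> `|alpha| <= A -> diffset x (2 ^ n.+1) d ->
      (2 * A)^-1 <= `|d| -> dist_int (alpha * d) < dyadic_threshold (1 + eps) n ->
      E n alpha.
Proof.
move=> eps00 eps_gt0 C0 A0 hcov.
have ln2 : 0 < ln 2 :> R by apply: ln_gt0; rewrite ltr1n.
(* The smaller exponent makes [w n / Q n] dominate both the threshold and, up to the factor [L], the
   covering radius. *)
pose a := Num.min eps eps0.
have a0 : 0 < a by rewrite lt_min eps_gt0.
pose w n : R := (n.+1%:R `^ (1 + a))^-1.
pose Q n : R := 2 ^+ n.+1.
have Q0 n : 0 < Q n by rewrite exprn_gt0.
have Q1 n : 1 <= Q n by rewrite exprn_ege1// ler1n.
have w0 n : 0 < w n by rewrite invr_gt0 powR_gt0.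
have w1 n : w n <= 1.
  rewrite invf_le1 ?powR_gt0//.
  rewrite -[X in X <= _](powRr0 n.+1%:R) ler_powR ?ler1n//; lra.
pose L := (ln 2 `^ (1 + eps0))^-1.
have L0 : 0 < L by rewrite invr_gt0 powR_gt0.
pose gam n : R := 1 / ((2 ^ n.+1)%:R * powR (ln ((2 ^ n.+1)%:R)) (1 + eps0)).
have wle s n : a <= s -> (n.+1%:R `^ (1 + s))^-1 <= w n.
  move=> as_; rewrite lef_pV2 ?posrE ?powR_gt0// ler_powR ?ler1n//; lra.
have gamE n : gam n = L * (n.+1%:R `^ (1 + eps0))^-1 / Q n.
  rewrite /gam natrX lnXn// -[_ *+ n.+1]mulr_natl powRM// ?(ltW ln2)// div1r /L /Q !invfM.
  ring.
have gam0 n : 0 < gam n.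
  by rewrite gamE divr_gt0// mulr_gt0// invr_gt0 powR_gt0.
have gamle n : gam n <= L * w n / Q n.
  by rewrite gamE ler_wpM2r ?invr_ge0 ?(ltW (Q0 n))// ler_wpM2l ?(ltW L0)// wle// ge_min lexx orbT.
have psile n : dyadic_threshold (1 + eps) n <= w n / Q n.
  rewrite /dyadic_threshold invfM mulrC ler_wpM2r ?invr_ge0 ?(ltW (Q0 n))//.
  by rewrite wle// ge_min lexx.
(* For [2 ^ n.+1 >= T] both [gam n <= (4 * A)^-1] and the enlarged radius is at most 1. *)
pose T := 1 + A * L + 4 * A * L.
have T0 : 0 < T by rewrite !addr_gt0 ?mulr_gt0.
pose n0 := Num.truncn T.
have TQ n : (n0 <= n)%N -> T <= Q n.
  move=> n0n; apply/ltW; apply: (@lt_le_trans _ _ n.+1%:R).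
    by rewrite (lt_le_trans (truncnS_gt _))// ler_nat.
  by rewrite /Q -natrX ler_nat ltnW// ltn_expl.
(* The factor [C + 1] absorbs the slack in the cover size, [C * Q n + 1 <= (C + 1) * Q n]; the [Q n]
   centres then cancel the [Q n] in the radius and leave [w n]. *)
pose G := (C + 1) * ((2 * A + 3 / (4 * A)^-1) * (2 * (1 + A * L))).
have c0 : 0 <= 2 * A + 3 / (4 * A)^-1 by rewrite invrK; lra.
have AL0 : 0 <= A * L by rewrite mulr_ge0// ltW.
have G0 : 0 <= G.
  apply: mulr_ge0; first by rewrite addr_ge0// ltW.
  by apply: mulr_ge0 => //; rewrite mulr_ge0// addr_ge0.
pose P n (E : set R) := [/\ measurable E, (mu E <= (G * w n)%:E)%E &
    (n0 <= n)%N -> forall alpha d, `|alpha| <= A -> diffset x (2 ^ n.+1) d ->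
      (2 * A)^-1 <= `|d| -> dist_int (alpha * d) < dyadic_threshold (1 + eps) n ->
      E alpha].
have /choice[E EP] : forall n, exists E, P n E.
  (* Below [n0] nothing is required, so the empty set serves. *)
  move=> n; case: (leqP n0 n) => [n0n|nn0]; last first.
    exists set0; split => //; last by rewrite leqNgt nn0.
    by rewrite measure0 lee_fin mulr_ge0// ltW.
  have N2 : (2 <= 2 ^ n.+1)%N by rewrite -{1}(expn1 2) leq_exp2l.
  have [B cB sB] := cov_le_witness _ _ _ (diffset_covered x (2 ^ n.+1) _ (gam0 n)) (hcov _ N2).
  have etale : dyadic_threshold (1 + eps) n + A * gam n <= (1 + A * L) * w n / Q n.
    have := ler_wpM2l (ltW A0) (gamle n); have := psile n; lra.
  have QT := TQ n n0n.
  have [||||E [mE bE EP]] := covered_bad_set (diffset x (2 ^ n.+1)) B A (4 * A)^-1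
    (gam n) (dyadic_threshold (1 + eps) n) (ltW A0) _ _ _ _ cB.
  - by rewrite invr_gt0 mulr_gt0.
  - rewrite (ltW (gam0 n)) /=; apply: (le_trans (gamle n)).
    rewrite ler_pdivrMr// ler_pdivlMl ?mulr_gt0//.
    apply: (@le_trans _ _ (4 * A * L)).
      by rewrite mulrA ler_piMr// !mulr_ge0// ltW.
    by apply: le_trans QT; rewrite lerDr addr_ge0// mulr_ge0// ltW.
  - exact: ltW (dyadic_threshold_gt0 _ _).
  - apply: (le_trans etale); rewrite ler_pdivrMr// mul1r.
    apply: (@le_trans _ _ (1 + A * L)).
      by rewrite ler_piMr// addr_ge0// mulr_ge0// ltW.
    by apply: le_trans QT; rewrite lerDl !mulr_ge0// ltW.
  exists E; split => //; last first.
    move=> _ alpha d alA Dd dA; apply: EP => //.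
    suff -> : 2 * (4 * A)^-1 = (2 * A)^-1 by [].
    by field; rewrite gt_eqF.
  apply: (le_trans bE); rewrite lee_fin.
  have -> : G * w n = ((C + 1) * Q n) * ((2 * A + 3 / (4 * A)^-1) *
      (2 * ((1 + A * L) * w n / Q n))).
    by rewrite /G; field; rewrite !gt_eqF.
  have eta0 : 0 <= dyadic_threshold (1 + eps) n + A * gam n.
    apply: addr_ge0; first exact: ltW (dyadic_threshold_gt0 _ _).
    by rewrite mulr_ge0// ltW.
  apply: ler_pM => //; first by rewrite !mulr_ge0.
  - apply: (le_trans (ltW sB)); rewrite natrX mulrDl mul1r lerD2l; exact: Q1.
  - by rewrite ler_wpM2l// ler_wpM2l.
exists E, n0; split.
  by apply: (@negligible_lim_sup_set R E G a a0) => n; have [] := EP n.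
move=> n alpha d n0n; have [_ _ /(_ n0n)] := EP n; exact.
Qed.

End dyadic_scales.

(** * Assembly for almost every [alpha] *)

Theorem theorem10 (R : realType) (x : nat -> R) (c eps0 : R) :
  0 < c ->
  (forall n : nat, (1 <= n)%N -> c * ln (n%:R) / n%:R <= x n.+1 - x n) ->
  (forall m n : nat, (1 <= m)%N -> (1 <= n)%N -> x m = x n -> m = n) ->
  0 < eps0 ->
  (exists C : R, 0 < C /\ forall N : nat, (2 <= N)%N ->
      cov (diffset x N) (1 / (N%:R * powR (ln (N%:R)) (1 + eps0))) <= C * N%:R) ->
  forall eps : R, 0 < eps ->
    {ae (@lebesgue_measure R), forall alpha : R,
       exists K : R, 0 < K /\ forall N : nat, (2 <= N)%N ->
         K / (N%:R * powR (ln (N%:R)) (1 + eps)) <= delta_min x alpha N}.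
Proof.
move=> c0 gap inj eps00 [C [C0 hcov]] eps eps_gt0.
have x12 : x 1%N != x 2%N by apply/eqP => /inj; move=> /(_ isT isT).
have [g g0 spacing] := spacing_lower_bound x c c0 gap x12.
(* Letting [A] run through the positive integers covers all [alpha] with countably many null
   sets. *)
have /choice[E /choice[n0 En0]] := fun j : nat =>
  bad_sequence x eps0 eps C j.+1%:R eps00 eps_gt0 C0 (ltr0Sn R j) hcov.
(* The point 0 joins the exceptional set: every distance vanishes there. *)
have nul : (@lebesgue_measure R).-negligible
    ([set 0] `|` \bigcup_j lim_sup_set (E j)).
  apply: negligibleU.
    by exists [set 0]; split; [exact: measurable_set1|exact: lebesgue_measure_set1|].
  by apply: negligible_bigcup => j; have [] := En0 j.
apply: negligibleS nul => alpha /= nogood.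
apply: contrapT => /not_orP[/= alpha0 notin]; apply: nogood.
have al0 : 0 < `|alpha| by rewrite normr_gt0; apply/eqP.
pose j := Num.truncn `|alpha|.
have alj : `|alpha| <= j.+1%:R by rewrite ltW// truncnS_gt.
have : ~ lim_sup_set (E j) alpha by move=> h; apply: notin; exists j.
(* From index [n1] on, [alpha] lies in no [E j n]. *)
move=> /existsNP[n1 /not_implyP[_ n1E]].
have [_ Ebad] := En0 j.
have [K K0 dyad] := dyadic_interpolation (1 + eps) (maxn (n0 j) n1)
  (ltW (addr_gt0 ltr01 eps_gt0)).
(* The value 1 serves differences that are not small, [|alpha| * g] those controlled by spacing. *)
pose h := Num.min 1 (`|alpha| * g).
have h0 : 0 < h by rewrite lt_min ltr01 mulr_gt0.
exists (h * K); split => [|N N2]; first exact: mulr_gt0.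
have [n [+ Nn thr]] := dyad N N2; rewrite geq_max => /andP[n0n n1n].
apply: lb_le_inf.
  by exists (dist_int (alpha * x 1%N - alpha * x 2%N)), 1%N, 2%N; split=> //; rewrite (ltnW N2).
move=> _ [p [q [pN qN pq ->]]].
rewrite -mulrBr -mulrA.
apply: (@le_trans _ _ (h * dyadic_threshold (1 + eps) n)).
  by rewrite ler_wpM2l// ltW.
have t0 := dyadic_threshold_gt0 (1 + eps) n.
have widen i : (1 <= i <= N)%N -> (1 <= i <= 2 ^ n.+1)%N.
  by move=> /andP[-> iN] /=; exact: leq_trans Nn.
have [big|small] := leP (2 * j.+1%:R)^-1 `|x p - x q|.
  apply: (@le_trans _ _ (dyadic_threshold (1 + eps) n)).
    by rewrite ler_piMl ?(ltW t0)// ge_min lexx.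
  rewrite leNgt; apply/negP => lt; apply: n1E; exists n => //=.
  apply: (Ebad n alpha (x p - x q)) => //.
  by exists p, q; split => //; exact: widen.
apply: (@le_trans _ _ `|alpha * (x p - x q)|); last first.
  apply: norm_le_dist_int; rewrite normrM.
  apply: (@le_trans _ _ (j.+1%:R * (2 * j.+1%:R)^-1)).
    by rewrite ler_pM// ltW.
  by rewrite invfM mulrCA mulfV ?mulr1.
rewrite normrM; apply: (@le_trans _ _ (`|alpha| * g * dyadic_threshold (1 + eps) n)).
  by rewrite ler_wpM2r ?(ltW t0)// ge_min lexx orbT.
rewrite -mulrA ler_pM2l//.
(* Spacing is used at [2 ^ n.+1] rather than [N], because the threshold is at most
   [1 / 2 ^ n.+1]. *)
apply: le_trans (spacing (2 ^ n.+1)%N p q (widen _ pN) (widen _ qN) pq).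
rewrite ler_pM2l// natrX lef_pV2 ?posrE ?mulr_gt0 ?exprn_gt0 ?powR_gt0//.
rewrite ler_peMr ?exprn_ge0//.
rewrite -[X in X <= _](powRr0 n.+1%:R) ler_powR ?ler1n//; lra.
Qed.
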